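(* Let $h$ be a function defined on $\mathbb{R}^+$ such that $h(0)=0$, $h$ is strictly increasing and $h$ is concave. Let $f$ be an $h$-$\mathrm{RG}^+$ convex function, and $x_0$ any starting point. Let $x_n$ be the output of the following heavy-ball method (with inputs $x_0$, $h$, $f_\star$): for $k=1,\dots,n$, choose $g_{k-1}$ from $\partial f(x_{k-1})$, and set $$\gamma_{k-1}=\frac1{2(k+1)}\,\frac{1}{h'\circ h^{-1}\bigl(f(x_{k-1})-f_\star\bigr)},\qquad x_k=x_{k-1}-\gamma_{k-1}g_{k-1}+\frac{k-1}{k+1}(x_{k-1}-x_{k-2}).$$ Then $$f(x_n)-f_\star\le h\!\left(\frac{d(x_0,\mathcal{X}_\star)^2}{n+1}\right).$$ In the following examples, this gives: 1. when $h$ is the linear function $h:z\mapsto\frac{Lz}{2}$ ($f$ is $L$-$\mathrm{QG}^+$ convex), then $f(x_n)-f_\star\le\frac L2\frac{d(x_0,\mathcal{X}_\star)^2}{n+1}$; 2. when $h$ is the function $h:z\mapsto M\sqrt z$ ($f$ is $M$-Lipschitz convex), then $f(x_n)-f_\star\le M\frac{d(x_0,\mathcal{X}_\star)}{\sqrt{n+1}}$; 3. when $h$ is the function $h:z\mapsto M\sqrt z+\frac{Lz}{2}$, then $f(x_n)-f_\star\le M\frac{d(x_0,\mathcal{X}_\star)}{\sqrt{n+1}}+\frac L2\frac{d(x_0,\mathcal{X}_\star)^2}{n+1}$.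
   Context: The functions $f:\mathbb{R}^d\to\mathbb{R}$ considered are convex (closed, proper) and are assumed to have a non-empty set of global minimizers $\mathcal{X}_\star$; $f_\star=\min_{x} f(x)$; $d(x,\mathcal{X}_\star)=\min_{x_\star\in\mathcal{X}_\star}\|x-x_\star\|_2$. $f$ is $h$-relatively upper bounded ($h$-$\mathrm{RG}^+$, written $f\in\mathrm{RG}^+(h)$) if $f(x)-f_\star\le h\bigl(d(x,\mathcal{X}_\star)^2\bigr)$ for all $x\in\mathbb{R}^d$; it is $L$-$\mathrm{QG}^+$ if $f(x)-f_\star\le\frac L2 d(x,\mathcal{X}_\star)^2$ for all $x\in\mathbb{R}^d$. For $h(z)=\frac{Lz}{2}$ the class $\mathrm{RG}^+(h)$ is the class of $L$-$\mathrm{QG}^+$ functions; for $h(z)=M\sqrt z$ the source identifies $\mathrm{RG}^+(h)$ with the class of $M$-Lipschitz continuous functions. $\partial f(x)=\{g:\ f(y)\ge f(x)+\langle g,y-x\rangle\ \forall y\in\mathbb{R}^d\}$ is the subdifferential. For $k=1$ the coefficient $\frac{k-1}{k+1}$ is zero, so no value of $x_{-1}$ is needed. *)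

(* Defs.v *)
From mathcomp Require Import all_boot all_order all_algebra.
From mathcomp Require Import all_classical all_reals all_analysis.
Set Implicit Arguments.
Unset Strict Implicit.
Unset Printing Implicit Defensive.
Import Order.TTheory GRing.Theory Num.Theory.
Import numFieldNormedType.Exports.
Local Open Scope classical_set_scope.
Local Open Scope ring_scope.

Definition dotp (R : realType) (d : nat) (u v : 'rV[R]_d) : R :=
  \sum_(i < d) u 0 i * v 0 i.

(* The library norm on 'rV[R]_d is the sup norm, hence this definition. *)
Definition norm2 (R : realType) (d : nat) (u : 'rV[R]_d) : R :=
  Num.sqrt (dotp u u).

Definition minimizers (R : realType) (d : nat) (f : 'rV[R]_d -> R)
    : set 'rV[R]_d :=
  [set x | forall y, f x <= f y].

(* A minimum whenever minimizers f is non-empty. *)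
Definition fstar (R : realType) (d : nat) (f : 'rV[R]_d -> R) : R :=
  inf (range f).

(* For a non-empty closed set A the infimum is attained. *)
Definition dist (R : realType) (d : nat) (x : 'rV[R]_d) (A : set 'rV[R]_d)
    : R :=
  inf [set norm2 (x - y) | y in A].

Definition RGplus (R : realType) (d : nat) (h : R -> R) (f : 'rV[R]_d -> R)
    : Prop :=
  forall x, f x - fstar f <= h (dist x (minimizers f) ^+ 2).

Definition QGplus (R : realType) (d : nat) (L : R) (f : 'rV[R]_d -> R)
    : Prop :=
  forall x, f x - fstar f <= L / 2 * dist x (minimizers f) ^+ 2.

Definition lipschitz2 (R : realType) (d : nat) (M : R) (f : 'rV[R]_d -> R)
    : Prop :=
  forall x y, `|f x - f y| <= M * norm2 (x - y).

Definition subdiff (R : realType) (d : nat) (f : 'rV[R]_d -> R)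
    (x : 'rV[R]_d) : set 'rV[R]_d :=
  [set g | forall y, f x + dotp g (y - x) <= f y].

Definition Rplus (R : realType) : set R := `[0, +oo[%classic.
Arguments Rplus : clear implicits.

(* A function on R^+ is represented by h : R -> R, of which only the values on
   R^+ matter. *)
Definition increasing_on_Rplus (R : realType) (h : R -> R) : Prop :=
  {in Rplus R &, {homo h : y z / y < z}}.

Definition concave_on_Rplus (R : realType) (h : R -> R) : Prop :=
  convex_function (Rplus R : set (convex_lmodType R^o)) (fun z => - h z).

(* The inverse of h : R^+ -> h(R^+). A concave increasing h with h 0 = 0 may
   jump at 0; the values in the jump are sent to 0, as by the generalized
   inverse y |-> inf {z >= 0 | y <= h z}. *)
Definition invRplus (R : realType) (h : R -> R) : R -> R :=
  'pinv_(fun=> 0) (Rplus R) h.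

(* The derivative of h, as a right derivative: this is the derivative at the
   end point 0 of R^+, where it may be +oo, it is h' wherever h is derivable
   (derivRplusE), and it exists at every point of R^+ for a concave h. *)
Definition derivRplus (R : realType) (h : R -> R) (z : R) : \bar R :=
  lim ((t^-1 * (h (z + t) - h z))%:E @[t --> 0^'+]).

Lemma derivRplusE (R : realType) (h : R -> R) (z : R) :
  derivable h z 1 -> derivRplus h z = (h^`()%classic z)%:E.
Proof.
move=> dh; apply: cvg_lim => //; apply: cvg_EFin; first by near=> t.
rewrite derive1E; apply: cvg_dnbhs_at_right.
have <- : (fun t : R => t^-1 *: (h (t *: 1 + z) - h z)) =
    fun t => t^-1 * (h (z + t) - h z).
  by apply/funext => t; rewrite /GRing.scale /= mulr1 addrC [t + z]addrC addrC.
exact: dh.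
Unshelve. all: by end_near. Qed.

(* The inverse is taken in \bar R, so that the step is 0 when h' is +oo. *)
Definition stepsize (R : realType) (d : nat) (f : 'rV[R]_d -> R) (h : R -> R)
    (k : nat) (x : 'rV[R]_d) : R :=
  (2 * k.+1%:R)^-1 *
  fine ((derivRplus h (invRplus h (f x - fstar f)))^-1)%E.

(* Only x 0, ..., x n and g 0, ..., g n.-1 are constrained. For k = 1 the
   momentum coefficient vanishes and k.-2 = 0 is a dummy index. *)
Definition heavy_ball (R : realType) (d : nat) (f : 'rV[R]_d -> R)
    (h : R -> R) (x0 : 'rV[R]_d) (n : nat) (x g : nat -> 'rV[R]_d) : Prop :=
  x 0%N = x0 /\
  forall k : nat, (1 <= k <= n)%N ->
    subdiff f (x k.-1) (g k.-1) /\
    x k = x k.-1 - stepsize f h k (x k.-1) *: g k.-1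
          + (k.-1%:R / k.+1%:R) *: (x k.-1 - x k.-2).

(* Main.v *)
Require Import Defs.
From mathcomp Require Import all_boot all_order all_algebra.
From mathcomp Require Import all_classical all_reals all_analysis.
From mathcomp Require Import ring lra.
Set Implicit Arguments.
Unset Strict Implicit.
Unset Printing Implicit Defensive.
Import Order.TTheory GRing.Theory Num.Theory.
Import numFieldNormedType.Exports.
Local Open Scope classical_set_scope.
Local Open Scope ring_scope.

(** Put z_k = h^-1 (f x_k - f_star), c_k = 1 / h'(z_k) and
    v_k = (k + 1) x_k - k x_(k-1). The method reads v_(k+1) = v_k - c_k g_k / 2.
    The tangent of h at z_k, the growth condition at p + c_k g_k / 2 and the
    subgradient inequality give, for every minimizer p,
      c_k <g_k, x_k - p> >= z_k + c_k^2 |g_k|^2 / 4  and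
      c_k <g_k, x_k - x_(k-1)> >= z_k - z_(k-1),
    so that |v_k - p|^2 + k z_(k-1) is nonincreasing in k. Since x_n is the
    convex combination (v_n + n x_(n-1)) / (n + 1), convexity of f, the growth
    condition at v_n and concavity of h yield the bound for x_n without a
    subgradient there. If h jumps at 0, then u <= h z only holds up to replacing
    z = h^-1 u by any larger number; the estimates are carried out in that form
    and the slack is removed at the end. *)

(** * Concave increasing functions on the half-line *)

Lemma convex_function_le (R : realType) (V : lmodType R)
    (D : set (convex_lmodType V)) (f : V -> R) (t : R) (a b : V) :
  convex_function D f -> 0 <= t -> t <= 1 -> D a -> D b ->
  f (t *: a + (1 - t) *: b) <= t * f a + (1 - t) * f b.
Proof.
by move=> cf t0 t1 Da Db; apply: (cf (Itv01 t0 t1) a b); rewrite inE.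
Qed.

Lemma RplusP (R : realType) (z : R) : Rplus R z <-> 0 <= z.
Proof. by rewrite /Rplus /= in_itv /= andbT. Qed.

Lemma concave_le (R : realType) (h : R -> R) (t a b : R) :
  concave_on_Rplus h -> 0 <= t -> t <= 1 -> 0 <= a -> 0 <= b ->
  t * h a + (1 - t) * h b <= h (t * a + (1 - t) * b).
Proof.
move=> ch t0 t1 /RplusP a0 /RplusP b0.
by have := convex_function_le ch t0 t1 a0 b0; rewrite /GRing.scale /=; lra.
Qed.

(** The three-slope inequality, cleared of denominators so that degenerate intervals are covered and
    linear arithmetic can use it. *)
Lemma concave_chord (R : realType) (h : R -> R) (a b c : R) :
  concave_on_Rplus h -> 0 <= a -> a <= b -> b <= c ->
  (c - b) * h a + (b - a) * h c <= (c - a) * h b.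
Proof.
move=> ch a0 ab bc.
have [ac|nac] := eqVneq a c.
  have -> : b = a by apply/eqP; rewrite eq_le ab ac bc.
  by rewrite ac subrr !mul0r addr0.
have ca : 0 < c - a by rewrite subr_gt0 lt_neqAle nac (le_trans ab bc).
have t0 : 0 <= (c - b) / (c - a) by rewrite divr_ge0 //; lra.
have t1 : (c - b) / (c - a) <= 1 by rewrite ler_pdivrMr // mul1r; lra.
have := concave_le ch t0 t1 a0 (le_trans a0 (le_trans ab bc)).
have -> : (c - b) / (c - a) * a + (1 - (c - b) / (c - a)) * c = b.
  by field; lra.
rewrite -(ler_pM2l ca); congr (_ <= _).
by field; lra.
Qed.

Lemma increasing_le (R : realType) (h : R -> R) (a b : R) :
  increasing_on_Rplus h -> 0 <= a -> a <= b -> h a <= h b.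
Proof.
move=> ih a0; rewrite le_eqVlt => /predU1P[->//|ab].
by apply/ltW/ih => //; rewrite inE; apply/RplusP => //; lra.
Qed.

Lemma increasing_lt (R : realType) (h : R -> R) (a b : R) :
  increasing_on_Rplus h -> 0 <= a -> a < b -> h a < h b.
Proof. by move=> ih a0 ab; apply/ih => //; rewrite inE; apply/RplusP; lra. Qed.

Lemma concave_ratio_le (R : realType) (h : R -> R) (s t : R) :
  h 0 = 0 -> concave_on_Rplus h -> 0 <= s -> s <= t -> s * h t <= t * h s.
Proof.
by move=> h0 ch s0 st; have := concave_chord ch (lexx 0) s0 st; rewrite h0; lra.
Qed.

(** Monotonicity and the decreasing ratio [h s / s] give [x * |h x - h y| <= h x * |x - y|] for
    positive [y]. At 0 a jump remains possible. *)
Lemma concave_continuous (R : realType) (h : R -> R) (x : R) :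
  h 0 = 0 -> increasing_on_Rplus h -> concave_on_Rplus h -> 0 < x ->
  {for x, continuous h}.
Proof.
move=> h0 ih ch x0; apply/cvgrPdist_le => e e0.
have hx : 0 < h x by rewrite -h0; apply: increasing_lt.
have d0 : 0 < Num.min x (e * x / h x) by rewrite lt_min x0 divr_gt0 // mulr_gt0.
exists (Num.min x (e * x / h x)) => //= y /=.
rewrite lt_min => /andP[xy]; rewrite ltr_pdivlMr // => exy.
have y0 : 0 < y by move: xy; rewrite ltr_norml; lra.
rewrite -(ler_pM2r x0); apply/ltW/(le_lt_trans _ exy).
have [lxy|lyx] := leP x y.
- have hxy := increasing_le ih (ltW x0) lxy.
  have := concave_ratio_le h0 ch (ltW x0) lxy.
  by rewrite !ler0_norm ?subr_le0 //; lra.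
- have hxy := increasing_le ih (ltW y0) (ltW lyx).
  have := concave_ratio_le h0 ch (ltW y0) (ltW lyx).
  by rewrite !ger0_norm ?subr_ge0 //; lra.
Qed.

(** [T] certifies that [u] does not exceed the range of [h]. By continuity on the positive reals, a
    value between [h s] and [h T] with [s > 0] is attained, so a missed value lies in the jump at
    0. *)
Lemma invRplusP (R : realType) (h : R -> R) (u T : R) :
  h 0 = 0 -> increasing_on_Rplus h -> concave_on_Rplus h ->
  0 <= u -> 0 <= T -> u <= h T ->
  (0 <= invRplus h u /\ h (invRplus h u) = u) \/
  (invRplus h u = 0 /\ 0 < u /\ forall s, 0 < s -> u < h s).
Proof.
move=> h0 ih ch u0 T0 uT.
have inj : {in Rplus R &, injective h}.
  move=> a b; rewrite !inE => /RplusP a0 /RplusP b0 hab.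
  by apply/eqP; rewrite eq_le !leNgt; apply/andP; split;
    apply/negP => /(increasing_lt ih); rewrite hab ltxx; auto.
have [[z /RplusP z0 <-]|nu] := pselect ((h @` Rplus R) u).
  by left; rewrite /invRplus pinvKV ?inE //; apply/RplusP.
right; split.
  (* Outside the image the partial inverse is undefined and falls back to its default 0. *)
  have E : 'oinv_([fun h in Rplus R]) u = None.
    by rewrite oinv_surj; case: pselect.
  by rewrite /invRplus /pinv_ splitV E.
have u_gt0 : 0 < u.
  rewrite lt_neqAle u0 andbT; apply/eqP => u00.
  by apply: nu; exists 0 => //; [apply/RplusP|rewrite h0].
split=> // s s0; rewrite ltNge; apply/negP => hsu.
have sT : s <= T.
  rewrite leNgt; apply/negP => Ts.
  by have := increasing_lt ih T0 Ts; lra.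
have [||c] := @IVT R h s T u sT.
- apply: continuous_subspace_itv => x; rewrite in_itv /= => /andP[sx _].
  by apply: concave_continuous => //; lra.
- by rewrite ge_min hsu /= le_max uT orbT.
- rewrite in_itv /= => /andP[sc _] hc; apply: nu; exists c => //.
  by apply/RplusP; lra.
Qed.

(** By concavity the difference quotients decrease in [t], so their limit at 0 from the right is a
    supremum, possibly [+oo]. *)
Lemma derivRplus_sup (R : realType) (h : R -> R) (z : R) :
  concave_on_Rplus h -> 0 <= z ->
  derivRplus h z =
  ereal_sup [set ((t^-1 * (h (z + t) - h z))%:E) | t in `]0, +oo[%classic].
Proof.
move=> ch z0; apply: cvg_lim => //.
apply: (@nonincreasing_at_right_cvge R
  (fun t => (t^-1 * (h (z + t) - h z))%:E) 0 +oo%O) => //.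
move=> s t; rewrite !in_itv /= !andbT => s0 t0 st.
have := @concave_chord _ h z (z + s) (z + t) ch z0.
rewrite lee_fin ![_^-1 * _]mulrC ler_pdivrMr // mulrAC ler_pdivlMr //.
by move=> H; have := H ltac:(lra) ltac:(lra); lra.
Qed.

(** Chord slopes on the left of [z] dominate those on the right, so the supremum is finite when
    [z > 0]. A finite value is a supergradient, positive because it dominates [h (z + 1) - h z]. *)
Lemma derivRplus_tangent (R : realType) (h : R -> R) (z : R) :
  increasing_on_Rplus h -> concave_on_Rplus h -> 0 <= z ->
  (z = 0 /\ derivRplus h z = +oo%E) \/
  exists D : R, [/\ derivRplus h z = D%:E, 0 < D &
    forall s, 0 <= s -> h s - h z <= D * (s - z)].
Proof.
move=> ih ch z0; rewrite (derivRplus_sup ch z0).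
set A := (X in ereal_sup X).
have qA t : 0 < t -> ((t^-1 * (h (z + t) - h z))%:E <= ereal_sup A)%E.
  by move=> t0; apply: ereal_sup_ubound; exists t => //=; rewrite in_itv /= t0.
have q1 : 0 < h (z + 1) - h z.
  by rewrite subr_gt0; apply: increasing_lt => //; lra.
have left_slope s : 0 <= s -> s < z ->
    (ereal_sup A <= ((z - s)^-1 * (h z - h s))%:E)%E.
  move=> s0 sz; apply: ge_ereal_sup => _ [t + <-].
  rewrite /= in_itv /= andbT => t0.
  rewrite lee_fin ![_^-1 * _]mulrC ler_pdivrMr // mulrAC ler_pdivlMr ?subr_gt0 //.
  by have := @concave_chord _ h s z (z + t) ch s0 ltac:(lra) ltac:(lra); lra.
case E : (ereal_sup A) qA left_slope => [D| |] qA left_slope.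
- right; exists D; split => //.
    by have := qA 1 ltr01; rewrite lee_fin invr1; lra.
  move=> s s0; have [sz|zs|->] := ltgtP s z; last by lra.
    have := left_slope s s0 sz.
    by rewrite lee_fin mulrC ler_pdivlMr ?subr_gt0 //; lra.
  have := qA (s - z) ltac:(lra).
  by rewrite lee_fin mulrC ler_pdivrMr ?subr_gt0 // [z + _]addrC subrK.
- left; split => //; apply/eqP; rewrite eq_le z0 andbT leNgt; apply/negP => zp.
  by have := left_slope 0 (lexx 0) zp.
- by have := qA 1 ltr01.
Qed.

(** The third bound asks for [z < s] strictly because of the jump at 0. The fourth is the tangent
    inequality divided by the slope; for an infinite slope, [c = 0] and [z = 0]. *)
Lemma invRplus_tangent (R : realType) (h : R -> R) (u T : R)
    (z := invRplus h u) (c := fine (derivRplus h z)^-1%E) :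
  h 0 = 0 -> increasing_on_Rplus h -> concave_on_Rplus h ->
  0 <= u -> 0 <= T -> u <= h T ->
  [/\ 0 <= z, 0 <= c, forall s, z < s -> u <= h s &
    forall s, 0 <= s -> c * (h s - u) <= s - z].
Proof.
move=> h0 ih ch u0 T0 uT.
have z0 : 0 <= z.
  by case: (invRplusP h0 ih ch u0 T0 uT) => [[]|[]] //; rewrite /z => ->.
have [[z00 D]|[D [DE D0 tang]]] := derivRplus_tangent ih ch z0.
  have c0 : c = 0 by rewrite /c D.
  split; rewrite ?c0 // => s zs; last by rewrite mul0r z00 subr0.
  case: (invRplusP h0 ih ch u0 T0 uT) => [[_ <-]|[_ [_ uh]]].
    by apply: (increasing_le ih z0); apply/ltW.
  by apply/ltW/uh; rewrite -z00.
have cE : c = D^-1 by rewrite /c DE /inve gt_eqF.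
have c0 : 0 < c by rewrite cE invr_gt0.
have [[_ hz]|[z00 [u_gt0 uh]]] := invRplusP h0 ih ch u0 T0 uT; last first.
  (* A jump excludes a finite slope at 0: at this point the tangent gives [h s <= u / 2], whereas
     [u < h s]. *)
  have s0 : 0 < u / (2 * D) by rewrite divr_gt0 // mulr_gt0.
  have := tang _ (ltW s0); have := uh _ s0; rewrite /z z00 h0 !subr0.
  have -> : D * (u / (2 * D)) = u / 2 by field; lra.
  by lra.
rewrite -/z in hz; split; rewrite ?(ltW c0) // => s zs.
  by rewrite -hz; apply: (increasing_le ih z0); apply/ltW.
by rewrite cE ler_pdivrMl // -hz; apply: tang.
Qed.

(** * Euclidean geometry and distance to the minimizers *)

Lemma dotpC (R : realType) (d : nat) (u v : 'rV[R]_d) : dotp u v = dotp v u.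
Proof. by apply: eq_bigr => i _; rewrite mulrC. Qed.

Lemma dotpDr (R : realType) (d : nat) (u v w : 'rV[R]_d) :
  dotp u (v + w) = dotp u v + dotp u w.
Proof. by rewrite -big_split; apply: eq_bigr => i _; rewrite mxE mulrDr. Qed.

Lemma dotpZr (R : realType) (d : nat) (a : R) (u v : 'rV[R]_d) :
  dotp u (a *: v) = a * dotp u v.
Proof. by rewrite mulr_sumr; apply: eq_bigr => i _; rewrite mxE mulrCA. Qed.

Lemma dotpNr (R : realType) (d : nat) (u v : 'rV[R]_d) :
  dotp u (- v) = - dotp u v.
Proof. by rewrite -scaleN1r dotpZr mulN1r. Qed.

Lemma dotpDl (R : realType) (d : nat) (u v w : 'rV[R]_d) :
  dotp (v + w) u = dotp v u + dotp w u.
Proof. by rewrite dotpC dotpDr !(dotpC u). Qed.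

Lemma dotpZl (R : realType) (d : nat) (a : R) (u v : 'rV[R]_d) :
  dotp (a *: v) u = a * dotp v u.
Proof. by rewrite dotpC dotpZr dotpC. Qed.

Lemma dotpNl (R : realType) (d : nat) (u v : 'rV[R]_d) :
  dotp (- v) u = - dotp v u.
Proof. by rewrite dotpC dotpNr dotpC. Qed.

Lemma dotpp_ge0 (R : realType) (d : nat) (u : 'rV[R]_d) : 0 <= dotp u u.
Proof. by apply: sumr_ge0 => i _; rewrite -expr2 sqr_ge0. Qed.

Lemma dotpp_le0 (R : realType) (d : nat) (u : 'rV[R]_d) : dotp u u <= 0 -> u = 0.
Proof.
move=> u0; have /eqP : dotp u u == 0 by rewrite eq_le u0 dotpp_ge0.
move=> /psumr_eq0P E; apply/rowP => i; rewrite mxE; apply/eqP.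
by rewrite -sqrf_eq0 expr2 E // => j _; rewrite -expr2 sqr_ge0.
Qed.

Lemma dotpp_sub (R : realType) (d : nat) (u v : 'rV[R]_d) (a : R) :
  dotp (u - a *: v) (u - a *: v) =
  dotp u u - 2 * a * dotp v u + a ^+ 2 * dotp v v.
Proof.
rewrite !(dotpDl, dotpDr, dotpNl, dotpNr, dotpZl, dotpZr) (dotpC u v).
by ring.
Qed.

Lemma norm2_ge0 (R : realType) (d : nat) (u : 'rV[R]_d) : 0 <= norm2 u.
Proof. exact: sqrtr_ge0. Qed.

Lemma sqr_norm2 (R : realType) (d : nat) (u : 'rV[R]_d) :
  norm2 u ^+ 2 = dotp u u.
Proof. by rewrite sqr_sqrtr // dotpp_ge0. Qed.

Lemma norm2C (R : realType) (d : nat) (u v : 'rV[R]_d) :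
  norm2 (u - v) = norm2 (v - u).
Proof. by rewrite -opprB /norm2 dotpNl dotpNr opprK. Qed.

Lemma dist_has_lbound (R : realType) (d : nat) (x : 'rV[R]_d)
    (A : set 'rV[R]_d) : has_lbound [set norm2 (x - y) | y in A].
Proof. by exists 0 => _ [y _ <-]; apply: norm2_ge0. Qed.

Lemma dist_le (R : realType) (d : nat) (x y : 'rV[R]_d) (A : set 'rV[R]_d) :
  A y -> dist x A <= norm2 (x - y).
Proof. by move=> Ay; apply: ge_inf; [apply: dist_has_lbound|exists y]. Qed.

Lemma dist_ge (R : realType) (d : nat) (x : 'rV[R]_d) (A : set 'rV[R]_d) (r : R) :
  A !=set0 -> (forall y, A y -> r <= norm2 (x - y)) -> r <= dist x A.
Proof.
move=> [y Ay] H; apply: lb_le_inf; first by exists (norm2 (x - y)), y.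
by move=> _ [w Aw <-]; apply: H.
Qed.

Lemma dist_ge0 (R : realType) (d : nat) (x : 'rV[R]_d) (A : set 'rV[R]_d) :
  A !=set0 -> 0 <= dist x A.
Proof. by move=> A0; apply: dist_ge => // y _; apply: norm2_ge0. Qed.

(** An approximate projection onto [A], standing in for a nearest point. *)
Lemma dist_sqr_approx (R : realType) (d : nat) (x : 'rV[R]_d)
    (A : set 'rV[R]_d) (r : R) :
  A !=set0 -> dist x A ^+ 2 < r -> exists2 y, A y & dotp (x - y) (x - y) < r.
Proof.
move=> A0 dr; have d0 := dist_ge0 x A0.
have r0 : 0 <= r by apply/ltW/(le_lt_trans _ dr)/sqr_ge0.
have : dist x A < Num.sqrt r.
  by rewrite -(ltr_pXn2r (n := 2)) ?nnegrE ?sqrtr_ge0 // sqr_sqrtr.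
have [y Ay] := A0.
move=> /(inf_lt _)[|_ [w Aw <-] wr]; first by exists (norm2 (x - y)), y.
exists w => //; rewrite -sqr_norm2 -(sqr_sqrtr r0).
by rewrite ltr_pXn2r ?nnegrE ?sqrtr_ge0.
Qed.

Lemma fstarE (R : realType) (d : nat) (f : 'rV[R]_d -> R) (p : 'rV[R]_d) :
  minimizers f p -> fstar f = f p.
Proof.
move=> fp; apply/eqP; rewrite eq_le; apply/andP; split.
  by apply: ge_inf; [exists (f p) => _ [y _ <-]|exists p].
by apply: lb_le_inf; [exists (f p), p|move=> _ [y _ <-]].
Qed.

Lemma RGplus_le (R : realType) (d : nat) (h : R -> R) (f : 'rV[R]_d -> R)
    (p y : 'rV[R]_d) :
  increasing_on_Rplus h -> RGplus h f -> minimizers f p ->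
  f y <= f p + h (dotp (y - p) (y - p)).
Proof.
move=> ih rg fp; rewrite -lerBlDl -(fstarE fp); apply: le_trans (rg y) _.
apply: increasing_le => //; first exact: sqr_ge0.
have p0 : minimizers f !=set0 by exists p.
by rewrite -sqr_norm2 ler_pXn2r ?nnegrE ?norm2_ge0 ?dist_ge0 // dist_le.
Qed.

(** * The heavy-ball method *)

Definition inv_slope (R : realType) (h : R -> R) (u : R) : R :=
  fine (derivRplus h (invRplus h u))^-1%E.

(** The point v_k of the overview; at [k = 0] the second weight is 0 and v_0 = x_0. *)
Definition extrapolation (R : realType) (d : nat) (x : nat -> 'rV[R]_d)
    (k : nat) : 'rV[R]_d :=
  k.+1%:R *: x k - k%:R *: x k.-1.

(** Testing the subgradient at [p + t *: g] yields the gain [(c * t - t ^+ 2) * dotp g g], largest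
    at [t = c / 2]. The resulting term cancels the squared step of v_k. *)
Lemma subdiff_RGplus (R : realType) (d : nat) (h : R -> R) (f : 'rV[R]_d -> R)
    (p x g : 'rV[R]_d) (u := f x - f p) (c := inv_slope h u) :
  h 0 = 0 -> increasing_on_Rplus h -> concave_on_Rplus h -> RGplus h f ->
  minimizers f p -> subdiff f x g ->
  invRplus h u + c ^+ 2 / 4 * dotp g g <= c * dotp g (x - p).
Proof.
move=> h0 ih ch rg fp sg.
have u0 : 0 <= u by rewrite subr_ge0.
have uT : u <= h (dotp (x - p) (x - p)) by rewrite lerBlDl; apply: RGplus_le.
have [z0 c0 _ tang] := invRplus_tangent h0 ih ch u0 (dotpp_ge0 _) uT.
rewrite -/(inv_slope h u) -/c in c0 tang.
have := sg (p + (c / 2) *: g).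
have := RGplus_le (p + (c / 2) *: g) ih rg fp.
rewrite (_ : p + (c / 2) *: g - x = (c / 2) *: g - (x - p)); last first.
  by apply/rowP => i; rewrite !mxE; ring.
rewrite (_ : p + (c / 2) *: g - p = (c / 2) *: g); last first.
  by apply/rowP => i; rewrite !mxE; ring.
rewrite dotpZl !dotpZr [dotp g (_ - (x - p))]dotpDr dotpNr dotpZr => H1 H2.
have := tang (c / 2 * (c / 2 * dotp g g)).
have g0 := dotpp_ge0 g.
move=> /(_ ltac:(by rewrite !mulr_ge0 // divr_ge0)) H3.
(* Growth and subgradient inequalities are combined and multiplied by [c] here; the rest is
   linear. *)
have : 0 <= c * (h (c / 2 * (c / 2 * dotp g g)) - u
              - (c / 2 * dotp g g - dotp g (x - p))).
  by rewrite mulr_ge0 // /u; lra.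
by lra.
Qed.

(** Multiplied by [k + 2], the momentum term becomes [k] times the last displacement, which v_k
    already contains; a plain subgradient step is left. *)
Lemma momentum_extrapolation (R : realType) (d k : nat) (x : nat -> 'rV[R]_d)
    (g : 'rV[R]_d) (c : R) :
  x k.+1 = x k - ((2 * k.+2%:R)^-1 * c) *: g
           + (k%:R / k.+2%:R) *: (x k - x k.-1) ->
  extrapolation x k.+1 = extrapolation x k - (c / 2) *: g.
Proof.
move=> E; apply/rowP => i; rewrite /extrapolation /= E !mxE.
by field; rewrite -natr1 -natr1; have := ler0n R k; lra.
Qed.

(** Writing v_k - p = (x_k - p) + k (x_k - x_(k-1)), the two inner products with g_k make |v_k -
    p|^2 drop by at least z_k + k (z_k - z_(k-1)), the increase of the other term. *)
Lemma heavy_ball_potential (R : realType) (d : nat) (h : R -> R)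
    (f : 'rV[R]_d -> R) (p x0 : 'rV[R]_d) (n : nat) (x g : nat -> 'rV[R]_d) :
  h 0 = 0 -> increasing_on_Rplus h -> concave_on_Rplus h -> RGplus h f ->
  minimizers f p -> heavy_ball f h x0 n x g -> forall k, (k <= n)%N ->
  dotp (extrapolation x k - p) (extrapolation x k - p)
    + k%:R * invRplus h (f (x k.-1) - f p) <= dotp (x0 - p) (x0 - p).
Proof.
move=> h0 ih ch rg fp [x00 hb]; elim=> [_|k IH kn].
  by rewrite /extrapolation scale1r scale0r subr0 x00 mul0r addr0.
apply: le_trans (IH (ltnW kn)); have [/= sg] := hb k.+1 kn.
rewrite /stepsize (fstarE fp) -/(inv_slope h _).
move=> /momentum_extrapolation ->.
set c := inv_slope _ _; set v := extrapolation x k.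
rewrite addrAC dotpp_sub.
have Ev : dotp (g k) (v - p)
    = dotp (g k) (x k - p) + k%:R * dotp (g k) (x k - x k.-1).
  rewrite -dotpZr -dotpDr; congr dotp.
  by apply/rowP => i; rewrite !mxE -natr1; ring.
have := subdiff_RGplus h0 ih ch rg fp sg; rewrite -/c => H1.
have u0 y : 0 <= f y - f p by rewrite subr_ge0.
have uT y : f y - f p <= h (dotp (y - p) (y - p)).
  by rewrite lerBlDl; apply: RGplus_le.
have [z0 c0 _ tang] := invRplus_tangent h0 ih ch (u0 (x k)) (dotpp_ge0 _) (uT _).
have [w0 _ wle _] := invRplus_tangent h0 ih ch (u0 (x k.-1)) (dotpp_ge0 _) (uT _).
rewrite -/(inv_slope h _) -/c in c0 tang.
(* The tangent at z_k is evaluated at z_(k-1) + e, as [h] at z_(k-1) itself may lie below the jump;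
   then e tends to 0. *)
have H2 : c * (f (x k.-1) - f (x k)) <=
    invRplus h (f (x k.-1) - f p) - invRplus h (f (x k) - f p).
  apply/ler_addgt0Pr => e e0.
  have s0 : 0 <= invRplus h (f (x k.-1) - f p) + e by lra.
  rewrite addrAC; apply: le_trans (tang _ s0); apply: ler_wpM2l => //.
  by have := wle (invRplus h (f (x k.-1) - f p) + e) ltac:(lra); lra.
have H3 : c * (f (x k) - f (x k.-1)) <= c * dotp (g k) (x k - x k.-1).
  apply: ler_wpM2l => //; have := sg (x k.-1).
  by rewrite -(opprB (x k)) dotpNr; lra.
have := ler_wpM2l (ler0n R k) (_ : 0 <= c * dotp (g k) (x k - x k.-1)
  + invRplus h (f (x k.-1) - f p) - invRplus h (f (x k) - f p)).
rewrite mulr0 => /(_ ltac:(lra)) H4.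
rewrite Ev -[k.+1%:R]natr1; lra.
Qed.

(** The relation (k + 1) x_k = v_k + k x_(k-1) makes x_k the average of v_0, ..., v_k. *)
Lemma extrapolation_const (R : realType) (d k : nat) (x : nat -> 'rV[R]_d)
    (p : 'rV[R]_d) :
  (forall j, (j <= k)%N -> extrapolation x j = p) -> x k = p.
Proof.
elim: k => [|k IH] E.
  by rewrite -(E 0%N (leqnn _)) /extrapolation scale1r scale0r subr0.
have := E k.+1 (leqnn _); rewrite /extrapolation /= IH => [e|j jk]; last first.
  by apply/E/leqW.
apply: (@scalerI _ _ k.+2%:R); first by rewrite pnatr_eq0.
have /eqP := e; rewrite subr_eq => /eqP ->.
by rewrite -[k.+2%:R]natr1 scalerDl scale1r addrC.
Qed.

Lemma heavy_ball_last (R : realType) (d : nat) (h : R -> R)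
    (f : 'rV[R]_d -> R) (p x0 : 'rV[R]_d) (n : nat) (x g : nat -> 'rV[R]_d)
    (s : R) :
  convex_function (setT : set (convex_lmodType 'rV[R]_d)) f ->
  h 0 = 0 -> increasing_on_Rplus h -> concave_on_Rplus h -> RGplus h f ->
  minimizers f p -> heavy_ball f h x0 n x g ->
  dotp (x0 - p) (x0 - p) / n.+1%:R < s -> f (x n) - f p <= h s.
Proof.
move=> cf h0 ih ch rg fp hb ltDs.
have := heavy_ball_potential h0 ih ch rg fp hb (leqnn n).
set v := extrapolation x n; set w := x n.-1; set z := invRplus h _ => pot.
(* Both arguments of [h] are enlarged by this slack, so their weighted mean is still at most [s]. *)
pose e := s - dotp (x0 - p) (x0 - p) / n.+1%:R.
have e0 : 0 < e by rewrite subr_gt0.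
have uT y : f y - f p <= h (dotp (y - p) (y - p)).
  by rewrite lerBlDl; apply: RGplus_le.
have u0 : 0 <= f w - f p by rewrite subr_ge0.
have [z0 _ uz _] := invRplus_tangent h0 ih ch u0 (dotpp_ge0 _) (uT w).
rewrite -/z in z0 uz.
have n1 : 0 < n.+1%:R :> R by rewrite ltr0n.
pose t : R := n.+1%:R^-1.
have t0 : 0 < t by rewrite invr_gt0.
have t1 : t <= 1 by rewrite invf_le1 // ler1n.
have nt : n%:R * t = 1 - t.
  by rewrite /t -[n.+1%:R]natr1; field; have := ler0n R n; lra.
have xE : x n = t *: v + (1 - t) *: w.
  rewrite -nt; apply/rowP => i; rewrite !mxE /t -[n.+1%:R]natr1.
  by field; have := ler0n R n; lra.
have fx := @convex_function_le _ _ _ _ t v w cf (ltW t0) t1 I I.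
rewrite -xE in fx.
have v0 := dotpp_ge0 (v - p).
have hv : f v - f p <= h (dotp (v - p) (v - p) + e).
  by apply: le_trans (uT v) _; apply: increasing_le => //; lra.
have hz : f w - f p <= h (z + e) by apply: uz; lra.
have hc := concave_le (a := dotp (v - p) (v - p) + e) (b := z + e)
  ch (ltW t0) t1 ltac:(lra) ltac:(lra).
have les : t * (dotp (v - p) (v - p) + e) + (1 - t) * (z + e) <= s.
  have := ler_wpM2l (ltW t0) pot; rewrite mulrDr mulrA [t * _%:R]mulrC nt.
  by rewrite [t * dotp (x0 - p) _]mulrC /e -/t; lra.
have lo : 0 <= t * (dotp (v - p) (v - p) + e) + (1 - t) * (z + e).
  by rewrite addr_ge0 // mulr_ge0 //; lra.
have := increasing_le ih lo les.
have := ler_wpM2l (ltW t0) hv.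
have := ler_wpM2l (_ : 0 <= 1 - t) hz; rewrite subr_ge0 => /(_ t1).
by lra.
Qed.

(** At positive distance, near-optimal [p] give the bound [h s] for every [s > t], and [s] decreases
    to [t]. At distance 0 a jump would spoil this limit, but then [x0] is a minimizer and the
    potential keeps all iterates there. *)
Lemma heavy_ball_rate (R : realType) (d : nat) (h : R -> R)
    (f : 'rV[R]_d -> R) (x0 : 'rV[R]_d) (n : nat) (x g : nat -> 'rV[R]_d) :
  convex_function (setT : set (convex_lmodType 'rV[R]_d)) f ->
  minimizers f !=set0 ->
  h 0 = 0 -> increasing_on_Rplus h -> concave_on_Rplus h -> RGplus h f ->
  heavy_ball f h x0 n x g ->
  f (x n) - fstar f <= h (dist x0 (minimizers f) ^+ 2 / n.+1%:R).
Proof.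
move=> cf f_min h0 ih ch rg hb.
have n1 : 0 < n.+1%:R :> R by rewrite ltr0n.
have [q fq] := f_min.
have := dist_ge0 x0 f_min; rewrite le_eqVlt => /predU1P[d0|d_gt0].
  have fx0 : minimizers f x0.
    move=> y; apply: le_trans (_ : fstar f <= f y); last by rewrite (fstarE fq).
    by have := rg x0; rewrite -d0 expr0n h0 subr_le0.
  rewrite -d0 expr0n mul0r h0 (fstarE fx0) (@extrapolation_const _ _ n x x0) ?subrr //.
  move=> j jn; apply/eqP; rewrite -subr_eq0; apply/eqP/dotpp_le0.
  have := heavy_ball_potential h0 ih ch rg fx0 hb jn.
  rewrite subrr [dotp 0 0]big1 => [|i _]; last by rewrite mxE mul0r.
  have u0 : 0 <= f (x j.-1) - f x0 by rewrite subr_ge0.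
  have uT : f (x j.-1) - f x0 <= h (dotp (x j.-1 - x0) (x j.-1 - x0)).
    by rewrite lerBlDl; apply: RGplus_le.
  have [z0 _ _ _] := invRplus_tangent h0 ih ch u0 (dotpp_ge0 _) uT.
  by move=> H; apply: le_trans H; rewrite lerDl mulr_ge0.
set t := _ / _.
have t0 : 0 < t by rewrite divr_gt0 // exprn_gt0.
have H s : t < s -> f (x n) - fstar f <= h s.
  rewrite ltr_pdivrMr // => /(dist_sqr_approx f_min)[p fp].
  rewrite -ltr_pdivrMr // (fstarE fp).
  exact: (heavy_ball_last cf h0 ih ch rg fp hb).
have ht : 0 < h t by rewrite -h0; apply: increasing_lt.
apply/ler_addgt0Pr => e e0.
(* Chosen so that [s * h t / t = h t + e], which bounds [h s] by the decreasing ratio. *)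
pose s := t + e * t / h t.
have ts : t < s by rewrite ltrDl divr_gt0 // mulr_gt0.
apply: le_trans (H s ts) _.
have := concave_ratio_le h0 ch (ltW t0) (ltW ts).
have -> : s * h t = t * (h t + e) by rewrite /s; field; rewrite gt_eqF.
by rewrite ler_pM2l.
Qed.

(** * The square root profile and Lipschitz functions *)

Lemma sqrt_concave (R : realType) (t a b : R) :
  0 <= t -> t <= 1 -> 0 <= a -> 0 <= b ->
  t * Num.sqrt a + (1 - t) * Num.sqrt b <= Num.sqrt (t * a + (1 - t) * b).
Proof.
move=> t0 t1 a0 b0; rewrite -{2}(sqr_sqrtr a0) -{2}(sqr_sqrtr b0).
have p0 := sqrtr_ge0 a; have q0 := sqrtr_ge0 b.
move: (Num.sqrt a) (Num.sqrt b) p0 q0 => p q p0 q0.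
have s0 : 0 <= t * p + (1 - t) * q by rewrite addr_ge0 // mulr_ge0 //; lra.
rewrite -(ger0_norm s0) -sqrtr_sqr; apply: ler_wsqrtr.
have : 0 <= t * (1 - t) * (p - q) ^+ 2.
  by rewrite mulr_ge0 ?sqr_ge0 // mulr_ge0 //; lra.
by lra.
Qed.

(** This family contains all three example profiles; [M = 0] or [L = 0] gives the pure ones. *)
Lemma sqrt_linear_increasing (R : realType) (M L : R) :
  0 <= M -> 0 <= L -> 0 < M + L ->
  increasing_on_Rplus (fun z : R => M * Num.sqrt z + L * z / 2).
Proof.
move=> M0 L0 ML y z; rewrite !inE /= => /RplusP y0 /RplusP z0 yz.
have sq : Num.sqrt y < Num.sqrt z by rewrite ltr_sqrt //; lra.
have Lyz := ler_wpM2l L0 (ltW yz).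
have [M_gt0|M_le0] := ltP 0 M.
  by have : M * Num.sqrt y < M * Num.sqrt z; [rewrite ltr_pM2l|lra].
have Myz := ler_wpM2l M0 (ltW sq).
by have : L * y < L * z; [rewrite ltr_pM2l //; lra|lra].
Qed.

Lemma sqrt_linear_concave (R : realType) (M L : R) :
  0 <= M -> concave_on_Rplus (fun z : R => M * Num.sqrt z + L * z / 2).
Proof.
move=> M0 t a b; rewrite !inE => /RplusP a0 /RplusP b0.
have s0 : 0 <= t%:num by [].
have s1 : t%:num <= 1 by [].
have := ler_wpM2l M0 (sqrt_concave s0 s1 a0 b0).
set s : R := t%:num => H.
change (- (M * Num.sqrt (s * a + (1 - s) * b) + L * (s * a + (1 - s) * b) / 2)
  <= s * - (M * Num.sqrt a + L * a / 2)
     + (1 - s) * - (M * Num.sqrt b + L * b / 2)).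
by lra.
Qed.

(** A chord steeper than [M], prolonged by convexity, would leave the cone of slope [M] above a
    minimizer. *)
Lemma RGplus_sqrt_lipschitz (R : realType) (d : nat) (f : 'rV[R]_d -> R) (M : R) :
  convex_function (setT : set (convex_lmodType 'rV[R]_d)) f ->
  minimizers f !=set0 -> 0 < M ->
  RGplus (fun z => M * Num.sqrt z) f -> lipschitz2 M f.
Proof.
move=> cf [p fp] M0 rg.
have f_le y : f y - f p <= M * norm2 (y - p).
  rewrite -(fstarE fp); apply: le_trans (rg y) _; rewrite ler_pM2l //.
  have p0 : minimizers f !=set0 by exists p.
  by rewrite sqrtr_sqr ger0_norm ?dist_ge0 // dist_le.
have sub_le x y : f y - f x <= M * norm2 (y - x).
  have [le0|D0] := leP (f y - f x) 0.
    by apply: le_trans le0 _; rewrite mulr_ge0 ?norm2_ge0 // ltW.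
  rewrite leNgt; apply/negP => lt.
  set D := f y - f x in D0 lt.
  (* Along the ray [x + s (y - x)], [f] grows at least like [s * D] by
     convexity, and at most like [s * M * |y - x|] since it stays below the
     cone with apex [p]. *)
  pose P := dotp (x - p) (x - p); pose Q := dotp (y - x) (y - x).
  have ray s : 1 <= s -> s ^+ 2 * D ^+ 2 <= M ^+ 2 * ((1 + s) * (P + s * Q)).
    move=> s1; have sgt0 : 0 < s by lra.
    pose w := x + s *: (y - x).
    have si0 : 0 <= s^-1 by rewrite invr_ge0 ltW.
    have si1 : s^-1 <= 1 by rewrite invf_le1.
    have := @convex_function_le _ _ _ _ s^-1 w x cf si0 si1 I I.
    have -> : s^-1 *: w + (1 - s^-1) *: x = y.
      by apply/rowP => i; rewrite !mxE; field; lra.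
    move=> fy.
    have sD : s * D <= f w - f x.
      have := ler_wpM2l (ltW sgt0) fy.
      rewrite mulrDr !mulrA mulfV ?gt_eqF // mul1r mulrBr mulfV ?gt_eqF //.
      by rewrite mulr1 /D; lra.
    have wM : s * D <= M * norm2 (w - p).
      by apply: le_trans (f_le w); have := fp x; lra.
    have : (s * D) ^+ 2 <= (M * norm2 (w - p)) ^+ 2.
      by rewrite ler_pXn2r // nnegrE mulr_ge0 ?norm2_ge0 // ltW.
    rewrite !exprMn sqr_norm2 => H; apply: le_trans H _.
    rewrite ler_pM2l ?exprn_gt0 //.
    (* The cross term [2 * dotp (y - x) (x - p)] is at most [P + Q]. *)
    have := dotpp_ge0 ((x - p) - (1 : R) *: (y - x)); rewrite dotpp_sub -/P -/Q.
    have -> : w - p = (x - p) - (- s) *: (y - x).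
      by apply/rowP => i; rewrite !mxE; ring.
    rewrite dotpp_sub -/P -/Q => H.
    by have := mulr_ge0 (ltW sgt0) H; lra.
  have P0 : 0 <= P := dotpp_ge0 _; have Q0 : 0 <= Q := dotpp_ge0 _.
  have gap : 0 < D ^+ 2 - M ^+ 2 * Q.
    have N0 : 0 <= M * norm2 (y - x) by rewrite mulr_ge0 ?norm2_ge0 // ltW.
    by rewrite subr_gt0 /Q -sqr_norm2 -exprMn ltr_pXn2r // nnegrE // ltW.
  (* For [s >= 1], [ray] forces [s * (D ^+ 2 - M ^+ 2 * Q) <= K]; the [s] below makes the left side
     exceed [K] by the positive gap. *)
  pose K := M ^+ 2 * (2 * P + Q).
  have K0 : 0 <= K by rewrite mulr_ge0 ?sqr_ge0 //; lra.
  pose s := 1 + K / (D ^+ 2 - M ^+ 2 * Q).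
  have s1 : 1 <= s by rewrite lerDl divr_ge0 // ltW.
  have sg : s * (D ^+ 2 - M ^+ 2 * Q) = D ^+ 2 - M ^+ 2 * Q + K.
    by rewrite /s mulrDl mul1r divfK // gt_eqF.
  have := ray s s1.
  have PM : 0 <= M ^+ 2 * P by rewrite mulr_ge0 ?sqr_ge0.
  have := mulr_ge0 (_ : 0 <= s - 1) PM; rewrite subr_ge0 => /(_ s1).
  have s2 : s * (s * (D ^+ 2 - M ^+ 2 * Q)) = s * (D ^+ 2 - M ^+ 2 * Q) + s * K.
    by rewrite {1}sg mulrDr.
  have : 0 < s * (D ^+ 2 - M ^+ 2 * Q) by apply: mulr_gt0 gap; lra.
  by rewrite /K in s2; lra.
move=> x y; rewrite ler_norml -lerNl opprB sub_le norm2C.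
by rewrite sub_le.
Qed.

Lemma lipschitz_RGplus_sqrt (R : realType) (d : nat) (f : 'rV[R]_d -> R) (M : R) :
  minimizers f !=set0 -> 0 < M ->
  lipschitz2 M f -> RGplus (fun z => M * Num.sqrt z) f.
Proof.
move=> f_min M0 lf x; rewrite sqrtr_sqr ger0_norm ?dist_ge0 // -ler_pdivrMl //.
apply: dist_ge => // p fp; rewrite ler_pdivrMl // (fstarE fp).
by apply: le_trans (lf x p); apply: ler_norm.
Qed.

(** * The general rate and its three instances *)

Theorem theorem3p3 (R : realType) (d : nat) (f : 'rV[R]_d -> R)
    (f_convex : convex_function (setT : set (convex_lmodType 'rV[R]_d)) f)
    (f_min : minimizers f !=set0) :
  (forall h : R -> R,
     h 0 = 0 -> increasing_on_Rplus h -> concave_on_Rplus h -> RGplus h f ->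
     forall (x0 : 'rV[R]_d) (n : nat) (x g : nat -> 'rV[R]_d),
       heavy_ball f h x0 n x g ->
       f (x n) - fstar f <= h (dist x0 (minimizers f) ^+ 2 / n.+1%:R)) /\
  (forall L : R, 0 < L ->
     let h := fun z : R => L * z / 2 in
     (RGplus h f <-> QGplus L f) /\
     (RGplus h f ->
      forall (x0 : 'rV[R]_d) (n : nat) (x g : nat -> 'rV[R]_d),
        heavy_ball f h x0 n x g ->
        f (x n) - fstar f
          <= L / 2 * (dist x0 (minimizers f) ^+ 2 / n.+1%:R))) /\
  (forall M : R, 0 < M ->
     let h := fun z : R => M * Num.sqrt z in
     (RGplus h f <-> lipschitz2 M f) /\
     (RGplus h f ->
      forall (x0 : 'rV[R]_d) (n : nat) (x g : nat -> 'rV[R]_d),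
        heavy_ball f h x0 n x g ->
        f (x n) - fstar f
          <= M * (dist x0 (minimizers f) / Num.sqrt n.+1%:R))) /\
  (forall M L : R, 0 <= M -> 0 <= L -> 0 < M + L ->
     let h := fun z : R => M * Num.sqrt z + L * z / 2 in
     RGplus h f ->
     forall (x0 : 'rV[R]_d) (n : nat) (x g : nat -> 'rV[R]_d),
       heavy_ball f h x0 n x g ->
       f (x n) - fstar f
         <= M * (dist x0 (minimizers f) / Num.sqrt n.+1%:R)
            + L / 2 * (dist x0 (minimizers f) ^+ 2 / n.+1%:R)).
Proof.
(* One instance of the general rate serves all three examples. *)
have rate M L (M0 : 0 <= M) (L0 : 0 <= L) (ML : 0 < M + L) := fun rg x0 n x g =>
  @heavy_ball_rate R d (fun z => M * Num.sqrt z + L * z / 2) f x0 n x g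
    f_convex f_min ltac:(by rewrite /= sqrtr0; lra)
    (sqrt_linear_increasing M0 L0 ML) (@sqrt_linear_concave _ M L M0) rg.
have sqrt_dist (x0 : 'rV[R]_d) n : Num.sqrt (dist x0 (minimizers f) ^+ 2 / n.+1%:R)
    = dist x0 (minimizers f) / Num.sqrt n.+1%:R.
  by rewrite sqrtrM ?sqr_ge0 // sqrtr_sqr ger0_norm ?dist_ge0 // sqrtrV ?ler0n.
split; last split; last split.
- by move=> h h0 ih ch rg x0 n x g; apply: heavy_ball_rate.
- move=> L L0 h; split.
    by split=> rg x; have := rg x; rewrite /h mulrAC.
  have hE : h = fun z => 0 * Num.sqrt z + L * z / 2.
    by apply/funext => z; rewrite mul0r add0r.
  move=> rg x0 n x g; rewrite hE in rg *.
  move=> /(rate 0 L (lexx _) (ltW L0) ltac:(lra) rg).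
  by rewrite mul0r add0r mulrAC.
- move=> M M0 h; split.
    split; first exact: RGplus_sqrt_lipschitz.
    exact: lipschitz_RGplus_sqrt.
  have hE : h = fun z => M * Num.sqrt z + 0 * z / 2.
    by apply/funext => z; rewrite !mul0r addr0.
  move=> rg x0 n x g; rewrite hE in rg *.
  move=> /(rate M 0 (ltW M0) (lexx _) ltac:(lra) rg).
  by rewrite !mul0r addr0 sqrt_dist.
- move=> M L M0 L0 ML h rg x0 n x g.
  move=> /(rate M L M0 L0 ML rg).
  by rewrite sqrt_dist [L * _ / 2]mulrAC.
Qed.
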